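(* Let $A(x_1,x_2)$, $C(x_1,x_2)$ be polynomials in two variables and $P(x)$ a polynomial in one variable, and let $m_1,n_1,m_2,n_2\in\mathbb{Z}$ be such that at least one of the conditions $m_1\neq n_1$ or $m_2\neq n_2$ holds. Consider a system of ordinary differential equations in the variables $x_1,x_2,e_1,e_2,r,\gamma_3$ which reduces to $$2\dot x_1=-\mathrm{i}f_1,\quad 2\dot x_2=\mathrm{i}f_2,\quad \dot e_1=-m e_1,\quad \dot e_2=m e_2,$$ where $m$ is some function of the system's variables, $$f_1=x_1^{m_1}r+x_1^{n_1}\gamma_3,\qquad f_2=x_2^{m_2}r+x_2^{n_2}\gamma_3,$$ and where the relations $$f_1^2=P(x_1)+e_1A(x_1,x_2),\qquad f_2^2=P(x_2)+e_2A(x_1,x_2),$$ $$P(x_2)e_1+P(x_1)e_2=C(x_1,x_2)-e_1e_2A(x_1,x_2)$$ hold. Put $\Delta=x_1^{m_1}x_2^{n_2}-x_2^{m_2}x_1^{n_1}$ and let $B(x_1,x_2)$ be defined by $$B^2(x_1,x_2)=4A(x_1,x_2)C(x_1,x_2)+4P(x_1)P(x_2).$$ Then, wherever the expressions below are defined, the relations $$r^2=E+p_2e_1+p_1e_2,\qquad r\gamma_3=F-q_2e_1-q_1e_2,\qquad \gamma_3^2=G+r_2e_1+r_1e_2,\qquad e_1e_2=k^2$$ ($k^2$ being a constant of motion) are satisfied with $$p_1=\frac{A\,x_1^{2n_1}}{\Delta^2},\quad p_2=\frac{A\,x_2^{2n_2}}{\Delta^2},\quad q_1=\frac{A\,x_1^{n_1+m_1}}{\Delta^2},\quad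 q_2=\frac{A\,x_2^{n_2+m_2}}{\Delta^2},\quad r_1=\frac{A\,x_1^{2m_1}}{\Delta^2},\quad r_2=\frac{A\,x_2^{2m_2}}{\Delta^2},$$ and with $(E,F,G)$ equal to one of the two triples $(E_j,F_j,G_j)$, $j=1,2$, where $$E_j=\frac{x_2^{2n_2}P(x_1)+x_1^{2n_1}P(x_2)\pm B(x_1,x_2)\,x_1^{n_1}x_2^{n_2}}{\Delta^2}$$ (the sign $+$ for $j=1$, the sign $-$ for $j=2$), $$F_j=\frac{E_j\left(x_1^{2m_1}x_2^{2n_2}-x_1^{2n_1}x_2^{2m_2}\right)+x_1^{2n_1}P(x_2)-x_2^{2n_2}P(x_1)}{2x_1^{n_1}x_2^{n_2}\left(x_1^{n_1}x_2^{m_2}-x_1^{m_1}x_2^{n_2}\right)},$$ $$G_j=\frac{E_j\,x_1^{m_1}x_2^{m_2}\left(x_1^{m_1}x_2^{n_2}-x_1^{n_1}x_2^{m_2}\right)+x_1^{m_1+n_1}P(x_2)-x_2^{m_2+n_2}P(x_1)}{x_1^{n_1}x_2^{n_2}\left(x_1^{m_1}x_2^{n_2}-x_1^{n_1}x_2^{m_2}\right)}.$$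
   Context: All variables are complex-valued functions of time $t$, the dot denotes $d/dt$, and $\mathrm{i}$ is the imaginary unit. The symbols $r_1,r_2$ denote coefficient functions of $(x_1,x_2)$, not to be confused with the variable $r$; $p_i,q_i,r_i,E,F,G$ are functions of $x_1,x_2$. Systems satisfying the differential equations and the three algebraic relations in the claim (for general functions $f_1,f_2$) are called systems of Kowalevski type. The equations for $e_1,e_2$ imply that $e_1e_2$ is a first integral, whose value is denoted $k^2$. *)

(* Defs.v *)
From mathcomp Require Import all_boot all_order all_algebra.
From mathcomp Require Import all_classical all_reals all_analysis.
From mathcomp Require Export complex.
From mathcomp Require Import polyXY.

Set Implicit Arguments.
Unset Strict Implicit.
Unset Printing Implicit Defensive.

Import Order.TTheory GRing.Theory Num.Theory.
Import numFieldNormedType.Exports.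

Local Open Scope ring_scope.
Local Open Scope classical_set_scope.

(* MathComp-Analysis provides no normed R-module structure on R[i], so the
   derivative of a complex-valued function of real time is taken
   componentwise. *)
Definition has_cderiv (R : realType) (z : R -> R[i]) (t : R) (dz : R[i]) :
    Prop :=
  is_derive t (1 : R) (fun s => complex.Re (z s)) (complex.Re dz) /\
  is_derive t (1 : R) (fun s => complex.Im (z s)) (complex.Im dz).

Record state (R : realType) := State {
  x1 : R[i]; x2 : R[i]; e1 : R[i]; e2 : R[i]; r : R[i]; g3 : R[i] }.

(* s : R -> state R is a motion, over the time set D, of the system
   2 x1' = -i f1, 2 x2' = i f2, e1' = -m e1, e2' = m e2.
   No equation is imposed on the derivatives of r and g3. *)
Definition solves (R : realType) (f1 f2 m : state R -> R[i])
    (D : set R) (s : R -> state R) : Prop :=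
  forall t, D t ->
  [/\ exists2 dx1, has_cderiv (fun a => x1 (s a)) t dx1
        & 2 * dx1 = - 'i%C * f1 (s t),
      exists2 dx2, has_cderiv (fun a => x2 (s a)) t dx2
        & 2 * dx2 = 'i%C * f2 (s t),
      has_cderiv (fun a => e1 (s a)) t (- m (s t) * e1 (s t)) &
      has_cderiv (fun a => e2 (s a)) t (m (s t) * e2 (s t))].

(* A polynomial in two variables is an element A of {poly {poly R[i]}}, with
   value A.[x, y] (see polyXY) at (x, y). *)
Definition kowalevski_relations (R : realType) (P : {poly R[i]})
    (A C : {poly {poly R[i]}}) (f1 f2 : state R -> R[i]) (u : state R) : Prop :=
  [/\ f1 u ^+ 2 = P.[x1 u] + e1 u * A.[x1 u, x2 u],
      f2 u ^+ 2 = P.[x2 u] + e2 u * A.[x1 u, x2 u] &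
      P.[x2 u] * e1 u + P.[x1 u] * e2 u =
        C.[x1 u, x2 u] - e1 u * e2 u * A.[x1 u, x2 u]].

Definition f1_mono (R : realType) (m1 n1 : int) (u : state R) : R[i] :=
  x1 u ^ m1 * r u + x1 u ^ n1 * g3 u.

Definition f2_mono (R : realType) (m2 n2 : int) (u : state R) : R[i] :=
  x2 u ^ m2 * r u + x2 u ^ n2 * g3 u.

Definition Delta (R : realType) (m1 n1 m2 n2 : int) (x y : R[i]) : R[i] :=
  x ^ m1 * y ^ n2 - y ^ m2 * x ^ n1.

(* 0 ^ n = 0 in MathComp for n < 0, where the power is meaningless. *)
Definition pow_defined (R : realType) (x : R[i]) (n : int) : bool :=
  (x != 0) || (0 <= n).

(* All the powers have a meaning and all the denominators are nonzero; in the
   powers with exponents 2 n1, n1 + m1, ... nothing further can go wrong. *)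
Definition formulas_defined (R : realType) (m1 n1 m2 n2 : int) (x y : R[i]) :
    bool :=
  [&& pow_defined x m1, pow_defined x n1, pow_defined y m2, pow_defined y n2,
      x ^ n1 != 0, y ^ n2 != 0 & Delta m1 n1 m2 n2 x y != 0].

(* The sign in front of B is (-1) ^+ j: + for j = false, - for j = true. *)
Definition Ecoef (R : realType) (P : {poly R[i]}) (B : R[i] -> R[i] -> R[i])
    (m1 n1 m2 n2 : int) (j : bool) (x y : R[i]) : R[i] :=
  (y ^ (2 * n2) * P.[x] + x ^ (2 * n1) * P.[y]
     + (-1) ^+ j * B x y * x ^ n1 * y ^ n2)
  / Delta m1 n1 m2 n2 x y ^+ 2.

Definition Fcoef (R : realType) (P : {poly R[i]}) (B : R[i] -> R[i] -> R[i])
    (m1 n1 m2 n2 : int) (j : bool) (x y : R[i]) : R[i] :=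
  (Ecoef P B m1 n1 m2 n2 j x y
     * (x ^ (2 * m1) * y ^ (2 * n2) - x ^ (2 * n1) * y ^ (2 * m2))
     + x ^ (2 * n1) * P.[y] - y ^ (2 * n2) * P.[x])
  / (2 * x ^ n1 * y ^ n2 * (x ^ n1 * y ^ m2 - x ^ m1 * y ^ n2)).

Definition Gcoef (R : realType) (P : {poly R[i]}) (B : R[i] -> R[i] -> R[i])
    (m1 n1 m2 n2 : int) (j : bool) (x y : R[i]) : R[i] :=
  (Ecoef P B m1 n1 m2 n2 j x y * x ^ m1 * y ^ m2
     * (x ^ m1 * y ^ n2 - x ^ n1 * y ^ m2)
     + x ^ (m1 + n1) * P.[y] - y ^ (m2 + n2) * P.[x])
  / (x ^ n1 * y ^ n2 * (x ^ m1 * y ^ n2 - x ^ n1 * y ^ m2)).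

(* Main.v *)
(* The relations between f_1, f_2 and (r, gamma_3) are linear with determinant
   Delta, so r^2, r gamma_3 and gamma_3^2 are quadratic forms in f_1, f_2.  The
   first two algebraic relations give the squares f_1^2, f_2^2; multiplying them
   and using the third one gives (2 f_1 f_2)^2 = 4 A C + 4 P(x_1) P(x_2) = B^2.
   Hence B = -2 f_1 f_2 or B = 2 f_1 f_2, and this choice is the choice of the
   triple (E_j, F_j, G_j). *)
Require Import Defs.
From mathcomp Require Import all_boot all_order all_algebra.
From mathcomp Require Import all_classical all_reals all_analysis.
From mathcomp Require Import complex polyXY.
From mathcomp Require Import ring.
Import Order.TTheory GRing.Theory Num.Theory.
Import numFieldNormedType.Exports.
Local Open Scope ring_scope.
Local Open Scope classical_set_scope.

(** Mean value theorem on the segment between the two times, which lies in [D] because [D] is an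
    interval. *)
Lemma derive0_interval_cst (R : realType) (D : set R) (f : R -> R) :
  is_interval D -> (forall t, D t -> is_derive t 1 f 0) ->
  forall t u, D t -> D u -> f t = f u.
Proof.
move=> iD df t u Dt Du.
wlog tu : t u Dt Du / t <= u.
  by move=> H; case: (leP t u) => [/H|/ltW /H ->] //; exact.
have Dtu x : x \in `[t, u]%R -> D x by rewrite in_itv /=; exact: iD.
have [||c _] := @MVT_segment R f (fun=> 0) t u tu.
- by move=> x xtu; apply/df/Dtu/(subset_itvW _ _ _ _ xtu).
- apply: derivable_within_continuous => x /Dtu /df dfx.
  exact: ex_derive.
by rewrite mul0r => /eqP; rewrite subr_eq0 => /eqP.
Qed.

(** Both components of a product are bilinear in the components of the factors, so the real product
    rule applies. It serves to differentiate [e1 * e2] along a motion. *)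
Lemma has_cderivM (R : realType) (z w : R -> R[i]) (t : R) (dz dw : R[i]) :
  has_cderiv z t dz -> has_cderiv w t dw ->
  has_cderiv (fun a => z a * w a) t (dz * w t + z t * dw).
Proof.
have ReM (u v : R[i]) : complex.Re (u * v) =
    complex.Re u * complex.Re v - complex.Im u * complex.Im v.
  by case: u; case: v.
have ImM (u v : R[i]) : complex.Im (u * v) =
    complex.Re u * complex.Im v + complex.Im u * complex.Re v.
  by case: u; case: v.
have ReD (u v : R[i]) : complex.Re (u + v) = complex.Re u + complex.Re v.
  exact: raddfD.
have ImD (u v : R[i]) : complex.Im (u + v) = complex.Im u + complex.Im v.
  exact: raddfD.
move=> [dzr dzi] [dwr dwi]; split.
  rewrite (_ : (fun s => _) = (fun s => complex.Re (z s)) * (fun s => complex.Re (w s)) -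
    (fun s => complex.Im (z s)) * (fun s => complex.Im (w s))); last first.
    by apply/funext => s; exact: ReM.
  apply: is_derive_eq.
  by rewrite ReD !ReM /GRing.scale /=; ring.
rewrite (_ : (fun s => _) = (fun s => complex.Re (z s)) * (fun s => complex.Im (w s)) +
  (fun s => complex.Im (z s)) * (fun s => complex.Re (w s))); last first.
  by apply/funext => s; exact: ImM.
apply: is_derive_eq.
by rewrite ImD !ImM /GRing.scale /=; ring.
Qed.

Lemma cderiv0_interval_cst (R : realType) (D : set R) (z : R -> R[i]) :
  is_interval D -> (forall t, D t -> has_cderiv z t 0) ->
  forall t u, D t -> D u -> z t = z u.
Proof.
move=> iD dz t u Dt Du; apply/eqP; rewrite eq_complex.
rewrite (derive0_interval_cst _ D (fun s => complex.Re (z s)) iD _ t u Dt Du).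
  rewrite (derive0_interval_cst _ D (fun s => complex.Im (z s)) iD _ t u Dt Du).
    by rewrite !eqxx.
  by move=> a /dz [].
by move=> a /dz [].
Qed.

Lemma exprz_double (K : unitRingType) (x : K) (n : int) :
  x ^ (2 * n) = (x ^ n) ^+ 2.
Proof. by rewrite mulrC -exprz_exp. Qed.

(* For x = 0 the hypothesis forces n = 0. *)
Lemma exprzD_neq0 (K : fieldType) (x : K) (n m : int) :
  x ^ n != 0 -> x ^ (n + m) = x ^ n * x ^ m.
Proof.
have [->|x0 _] := eqVneq x 0; last exact: expfzDr.
by rewrite exp0rz; case: (eqVneq n 0) => [-> _|_ /eqP//]; rewrite add0r mul1r.
Qed.

(** Here [X], [Y] stand for r, gamma_3, the coefficients [a], [b], [c], [d] for the powers of x_1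
    and x_2, and [Q] for B with its sign. Cramer's rule gives [X], hence [X ^+ 2]. The combination
    d^2 f_1^2 - b^2 f_2^2 is free of [Y ^+ 2] and yields [X * Y]; the combination a b f_2^2 - c d
    f_1^2 is free of [X * Y] and yields [Y ^+ 2]. This explains the shape of F and G in terms of
    E. *)
Lemma linear_system_quadratic (K : numFieldType)
    (a b c d X Y P1 P2 A u v Q : K) (dl := a * d - c * b)
    (E := (d ^+ 2 * P1 + b ^+ 2 * P2 + Q * b * d) / dl ^+ 2) :
  b != 0 -> d != 0 -> dl != 0 ->
  (a * X + b * Y) ^+ 2 = P1 + u * A -> (c * X + d * Y) ^+ 2 = P2 + v * A ->
  Q = - (2 * (a * X + b * Y) * (c * X + d * Y)) ->
  [/\ X ^+ 2 = E + A * d ^+ 2 / dl ^+ 2 * u + A * b ^+ 2 / dl ^+ 2 * v,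
      X * Y = (E * (a ^+ 2 * d ^+ 2 - b ^+ 2 * c ^+ 2)
                 + b ^+ 2 * P2 - d ^+ 2 * P1)
                / (2 * b * d * (b * c - a * d))
              - A * (d * c) / dl ^+ 2 * u - A * (b * a) / dl ^+ 2 * v &
      Y ^+ 2 = (E * a * c * (a * d - b * c) + b * a * P2 - d * c * P1)
                 / (b * d * (a * d - b * c))
               + A * c ^+ 2 / dl ^+ 2 * u + A * a ^+ 2 / dl ^+ 2 * v].
Proof.
(* Once [P1], [P2] and [Q] are eliminated, the claims are rational identities in free variables. *)
move=> b0 d0 dl0 /eqP; rewrite -subr_eq => /eqP P1E.
move=> /eqP; rewrite -subr_eq => /eqP P2E QE.
have dl0' : b * c - a * d != 0 by rewrite -oppr_eq0 opprB (mulrC b).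
rewrite /E /dl -P1E -P2E QE; split; field.
- exact: dl0.
- exact/and4P.
- exact/and3P.
Qed.

Theorem theorem1 (R : realType) (P : {poly R[i]}) (A C : {poly {poly R[i]}})
    (m1 n1 m2 n2 : int) (hmn : m1 != n1 \/ m2 != n2)
    (m : state R -> R[i])
    (B : R[i] -> R[i] -> R[i])
    (hB : forall x y : R[i],
       B x y ^+ 2 = 4 * A.[x, y] * C.[x, y] + 4 * P.[x] * P.[y])
    (D : set R) (oD : open D) (iD : is_interval D)
    (s : R -> state R)
    (hode : solves (f1_mono m1 n1) (f2_mono m2 n2) m D s)
    (hrel : forall t, D t ->
       kowalevski_relations P A C (f1_mono m1 n1) (f2_mono m2 n2) (s t)) :
  exists k : R[i], forall t, D t ->
    e1 (s t) * e2 (s t) = k ^+ 2 /\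
    (formulas_defined m1 n1 m2 n2 (x1 (s t)) (x2 (s t)) ->
     let x := x1 (s t) in
     let y := x2 (s t) in
     let d := Delta m1 n1 m2 n2 x y in
     let p1 := A.[x, y] * x ^ (2 * n1) / d ^+ 2 in
     let p2 := A.[x, y] * y ^ (2 * n2) / d ^+ 2 in
     let q1 := A.[x, y] * x ^ (n1 + m1) / d ^+ 2 in
     let q2 := A.[x, y] * y ^ (n2 + m2) / d ^+ 2 in
     let r1 := A.[x, y] * x ^ (2 * m1) / d ^+ 2 in
     let r2 := A.[x, y] * y ^ (2 * m2) / d ^+ 2 in
     exists j : bool,
       let E := Ecoef P B m1 n1 m2 n2 j x y in
       let F := Fcoef P B m1 n1 m2 n2 j x y in
       let G := Gcoef P B m1 n1 m2 n2 j x y in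
       [/\ r (s t) ^+ 2 = E + p2 * e1 (s t) + p1 * e2 (s t),
           r (s t) * g3 (s t) = F - q2 * e1 (s t) - q1 * e2 (s t) &
           g3 (s t) ^+ 2 = G + r2 * e1 (s t) + r1 * e2 (s t)]).
Proof.
have [k hk] : exists k : R[i], forall t, D t -> e1 (s t) * e2 (s t) = k ^+ 2.
  have [[t0 Dt0]|nD] := pselect (exists t, D t); last first.
    by exists 0 => t Dt; case: nD; exists t.
  (* A complex square root of the value of the first integral at one time of [D]. *)
  exists (sqrtc (e1 (s t0) * e2 (s t0))) => t Dt; rewrite sqr_sqrtc.
  apply: (cderiv0_interval_cst _ D (fun a => e1 (s a) * e2 (s a)) iD) => // a.
  (* The contributions - m e_1 e_2 and m e_1 e_2 cancel. *)
  move=> /hode [_ _ de1 de2]; have := has_cderivM _ _ _ _ _ _ de1 de2.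
  by congr has_cderiv; ring.
exists k => t Dt; split; first exact: hk.
move=> /and5P [_ _ _ _ /and3P [b0 d0 dl0]] /=.
have [h1 h2 h3] := hrel t Dt; have := hB (x1 (s t)) (x2 (s t)).
set x := x1 _ in h1 h2 h3 b0 d0 dl0 *; set y := x2 _ in h1 h2 h3 b0 d0 dl0 *.
set f1 := f1_mono _ _ _ in h1; set f2 := f2_mono _ _ _ in h2.
move=> hBxy.
have BE : B x y ^+ 2 = (2 * f1 * f2) ^+ 2.
  rewrite hBxy !exprMn h1 h2.
  (* C is split so that the right-hand side of the third relation appears; replacing it by the
     left-hand side makes the sum factor as 4 (P(x_1) + e_1 A) (P(x_2) + e_2 A). *)
  transitivity (4 * P.[x] * P.[y] + 4 * A.[x, y] *
    ((C.[x, y] - e1 (s t) * e2 (s t) * A.[x, y])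
     + e1 (s t) * e2 (s t) * A.[x, y])); first by ring.
  by rewrite -h3; ring.
(* The sign is chosen separately at each time [t], since only the square of [B] is prescribed. *)
have [j hj] : exists j : bool, (-1) ^+ j * B x y = - (2 * f1 * f2).
  move/eqP: BE; rewrite eqf_sqr => /orP[] /eqP ->.
    by exists true; rewrite expr1 mulN1r.
  by exists false; rewrite expr0 mul1r.
exists j; rewrite /Fcoef /Gcoef /Ecoef.
(* The exponents [n1], [n2] are moved to the front because splitting the power of a sum requires the
   first factor to be nonzero; the powers with exponents [m1], [m2] may vanish. *)
rewrite (addrC m1 n1) (addrC m2 n2) !exprz_double !exprzD_neq0//.
exact: linear_system_quadratic.
Qed.
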